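(* Consider the problem IsNecJR under the Lottery model: given an ABC instance under the Lottery model (voters $V=[n]$, candidates $C$, committee size $k$, and for each voter an explicitly listed finite probability distribution over approval sets) and a committee $W\subseteq C$ with $|W|=k$, decide whether $W$ satisfies JR with probability 1, i.e. whether $W$ satisfies JR with respect to every plausible approval profile. This problem is solvable in polynomial time.
   Context: An ABC instance consists of voters $V=[n]$, candidates $C=[m]$, an approval profile $A=(A_1,\dots,A_n)$ with $A_i\subseteq C$, and a positive integer $k$. A committee is a set $W\subseteq C$ with $|W|=k$. $W$ satisfies justified representation (JR) with respect to $A$ if for every $V'\subseteq V$ with $|V'|\ge \frac{n}{k}$ and $\bigcap_{i\in V'}A_i\neq\emptyset$, there is $i\in V'$ with $A_i\cap W\neq\emptyset$. In the Lottery model, each voter $i$ is given a probability distribution $\{(\lambda_r,S_r)\}_{r\in[s_i]}$ over $s_i$ approval sets $S_r\subseteq C$ with $\lambda_r>0$ and $\sum_r\lambda_r=1$; voters' approval sets are drawn independently. A plausible approval profile is an approval profile with positive probability. *)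

(* Defs.v *)
From HB Require Import structures.
From Corelib Require Import BinNums.
From mathcomp Require Import all_boot all_algebra.
Set Implicit Arguments. Unset Strict Implicit. Unset Printing Implicit Defensive.
Import GRing.Theory Num.Theory.

Inductive move := MoveL | MoveR | Stay.

Record TM := {
  tm_state : finType;
  tm_sym   : finType;
  tm_blank : tm_sym;
  tm_inp   : bool -> tm_sym;
  tm_start : tm_state;
  tm_halt  : tm_state -> bool;
  tm_acc   : tm_state -> bool;      (* accepting states (meaningful when halted) *)
  tm_delta : tm_state -> tm_sym -> tm_state * tm_sym * move
}.

(* configuration: state, tape left of head (nearest first), scanned symbol,
   tape right of head (nearest first); unlisted cells are blank *)
Record config (M : TM) := Conf {
  cstate : tm_state M;
  cleft  : seq (tm_sym M);
  ccur   : tm_sym M;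
  cright : seq (tm_sym M)
}.

Definition tm_step (M : TM) (c : config M) : config M :=
  let: Conf q l a r := c in
  if tm_halt q then c else
  let: (q', s, mv) := tm_delta q a in
  match mv with
  | MoveL => match l with
             | [::] => Conf q' [::] (tm_blank M) (s :: r)
             | x :: l' => Conf q' l' x (s :: r)
             end
  | MoveR => match r with
             | [::] => Conf q' (s :: l) (tm_blank M) [::]
             | x :: r' => Conf q' (s :: l) x r'
             end
  | Stay => Conf q' l s r
  end.

Definition tm_init (M : TM) (w : seq bool) : config M :=
  match map (tm_inp M) w with
  | [::] => Conf (tm_start M) [::] (tm_blank M) [::]
  | x :: r => Conf (tm_start M) [::] x r
  end.

Definition tm_run (M : TM) (t : nat) (w : seq bool) : config M :=
  iter t (@tm_step M) (tm_init M w).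

(* A lottery entry (p, q, S): approval set S (list of candidates) drawn with
   probability p/q. *)
Definition entry := (nat * nat * seq nat)%type.

Record lottery_instance := LotInst {
  li_n   : nat;                 (* voters V = {0,..,n-1} *)
  li_m   : nat;                 (* candidates C = {0,..,m-1} *)
  li_k   : nat;
  li_lot : seq (seq entry)
}.

Definition lam (e : entry) : rat := (e.1.1)%:R / (e.1.2)%:R.

Definition voter_lot (I : lottery_instance) (i : nat) : seq entry :=
  nth [::] (li_lot I) i.

Definition toset (m : nat) (s : seq nat) : {set 'I_m} := [set c : 'I_m | val c \in s].

Definition wf_input (I : lottery_instance) (W : seq nat) : Prop :=
  [/\ 0 < li_n I, 0 < li_k I, size (li_lot I) = li_n I,
      (forall i, i < li_n I ->
         all (fun e : entry => [&& 0 < e.1.1, 0 < e.1.2 & all (fun c => c < li_m I) e.2])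
             (voter_lot I i)
         /\ (\sum_(e <- voter_lot I i) lam e = 1 :> rat)%R)
    & [/\ uniq W, size W = li_k I & all (fun c => c < li_m I) W]].

Definition profile (I : lottery_instance) := 'I_(li_n I) -> {set 'I_(li_m I)}.

Definition prob_profile (I : lottery_instance) (A : profile I) : rat :=
  \prod_(i : 'I_(li_n I))
     \sum_(e <- voter_lot I i | toset (li_m I) e.2 == A i) lam e.

Definition plausible (I : lottery_instance) (A : profile I) : Prop :=
  (0 < prob_profile A)%R.

Definition JR (n m k : nat) (A : 'I_n -> {set 'I_m}) (W : {set 'I_m}) : Prop :=
  forall V' : {set 'I_n},
    (n%:R / k%:R <= (#|V'|)%:R :> rat)%R ->
    \bigcap_(i in V') A i != set0 ->
    exists2 i, i \in V' & A i :&: W != set0.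

Definition NecJR (I : lottery_instance) (W : seq nat) : Prop :=
  forall A : profile I, plausible A -> JR (li_k I) A (toset (li_m I) W).

Fixpoint pos_bits (p : positive) : seq bool :=
  match p with
  | xI p' => true :: pos_bits p'
  | xO p' => false :: pos_bits p'
  | xH => [:: true]
  end.

Definition nat_bits (n : nat) : seq bool :=
  match bin_of_nat n with
  | N0 => [::]
  | Npos p => pos_bits p
  end.

(* self-delimiting encoding: each digit d as (1,d), terminator (0,0) *)
Definition enc_nat (n : nat) : seq bool :=
  flatten [seq [:: true; b] | b <- nat_bits n] ++ [:: false; false].

Definition nats_of_entry (e : entry) : seq nat :=
  [:: e.1.1, e.1.2, size e.2 & e.2].

Definition nats_of_input (I : lottery_instance) (W : seq nat) : seq nat :=
  [:: li_n I, li_m I, li_k I & flatten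
      [seq size l :: flatten (map nats_of_entry l) | l <- li_lot I]]
  ++ size W :: W.

Definition encode (I : lottery_instance) (W : seq nat) : seq bool :=
  flatten (map enc_nat (nats_of_input I W)).

(* Main.v *)
Require Import Defs.
From mathcomp Require Import all_boot all_algebra.
From mathcomp Require Import all_order zify.
Set Implicit Arguments. Unset Strict Implicit. Unset Printing Implicit Defensive.

(** All listed probabilities are positive, so a plausible profile is an
    arbitrary choice of one listed set per voter.  Hence JR can fail iff some
    candidate c has at least n/k voters with a listed set that contains c and
    avoids W: those voters can all pick such a set simultaneously.  It suffices
    to let c range over the tokens of the input, so this is a condition on a
    constant number of positions in the input word and counters bounded by its
    length N.

    Such conditions are written as expressions of a small language whose values
    are numbers at most N (increment saturates at N) and whose only iteration is
    the bounded loop.  An expression is evaluated by a Turing machine that never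
    changes the input but keeps, for each register, a mark on the tape cell whose
    number is the value of the register; one elementary operation is one sweep
    over the tape, and bounded loops only multiply the time by N + 1. *)

(** * Programs on a marked tape *)

Section Fragments.

Variable r : nat.

(** The components of a cell are the input bit ([None] past the input), a flag for the left end, and
    the registers whose mark lies here. The tape itself has no left end, so the flag tells the head
    where to stop. *)
Definition sym : finType := (option bool * bool * {ffun 'I_r.+1 -> bool})%type.

Definition blank : sym := (None, false, [ffun=> false]).

Definition tape := (seq sym * sym * seq sym)%type.

Definition put (s : sym) (m : move) (tp : tape) : tape :=
  let: (l, _, r) := tp in
  match m with
  | MoveL => if l is x :: l' then (l', x, s :: r) else ([::], blank, s :: r)
  | MoveR => if r is x :: r' then (s :: l, x, r') else (s :: l, blank, [::])
  | Stay => (l, s, r)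
  end.

(** A transition leads to another state or leaves the fragment with an answer bit, so fragments are
    composed by redirecting exits. *)
Record frag := Frag {
  fs : finType;
  f0 : fs;
  fd : fs -> sym -> (fs + bool) * sym * move
}.

Inductive run (F : frag) : fs F -> tape -> bool -> tape -> nat -> Prop :=
| run_exit q tp b s m :
    fd q tp.1.2 = (inr b, s, m) -> run q tp b (put s m tp) 1
| run_step q tp q' s m b tp' t :
    fd q tp.1.2 = (inl q', s, m) -> run q' (put s m tp) b tp' t ->
    run q tp b tp' t.+1.

Definition If (F G H : frag) : frag :=
  @Frag (fs F + (fs G + fs H))%type (inl (f0 F)) (fun q a =>
    match q with
    | inl q =>
        let: (q', s, m) := fd q a in
        (match q' with
         | inl q1 => inl (inl q1)
         | inr b => inl (inr (if b then inl (f0 G) else inr (f0 H)))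
         end, s, m)
    | inr (inl q) =>
        let: (q', s, m) := fd q a in
        (match q' with inl q1 => inl (inr (inl q1)) | inr b => inr b end, s, m)
    | inr (inr q) =>
        let: (q', s, m) := fd q a in
        (match q' with inl q1 => inl (inr (inr q1)) | inr b => inr b end, s, m)
    end).

(** * Composition of fragments *)

Definition While (F G : frag) : frag :=
  @Frag (fs F + fs G)%type (inl (f0 F)) (fun q a =>
    match q with
    | inl q =>
        let: (q', s, m) := fd q a in
        (match q' with
         | inl q1 => inl (inl q1)
         | inr b => if b then inl (inr (f0 G)) else inr true
         end, s, m)
    | inr q =>
        let: (q', s, m) := fd q a in
        (match q' with inl q1 => inl (inr q1) | inr _ => inl (inl (f0 F)) end,
         s, m)
    end).

(** The run of the chosen branch is first lifted to the composite; induction on the run of [F] then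
    puts its steps in front. *)
Lemma run_If F G H tp b tp1 t1 b' tp2 t2 :
  run (f0 F) tp b tp1 t1 ->
  (if b then run (f0 G) tp1 b' tp2 t2 else run (f0 H) tp1 b' tp2 t2) ->
  run (f0 (If F G H)) tp b' tp2 (t1 + t2).
Proof.
move=> rF rGH.
have rb : @run (If F G H) (inr (if b then inl (f0 G) else inr (f0 H)))
    tp1 b' tp2 t2.
  case: b {rF} rGH.
    elim=> [q t c s m fq | q t q' s m c t' n fq _ IH].
      by apply: run_exit; rewrite /= fq.
    by apply: run_step IH; rewrite /= fq.
  elim=> [q t c s m fq | q t q' s m c t' n fq _ IH].
    by apply: run_exit; rewrite /= fq.
  by apply: run_step IH; rewrite /= fq.
rewrite /=; elim: rF rb {rGH} => [q t c s m fq | q t q' s m c t' n fq _ IH] rb.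
  by apply: run_step rb; rewrite /= fq.
by apply: run_step (IH rb); rewrite /= fq.
Qed.

Lemma run_While_exit F G tp tp1 t1 :
  run (f0 F) tp false tp1 t1 -> run (f0 (While F G)) tp true tp1 t1.
Proof.
rewrite /=; move Eb: false => b rF.
elim: rF Eb => [q t c s m fq | q t q' s m c t' n fq _ IH] Eb.
  by apply: run_exit; rewrite /= fq -Eb.
by apply: run_step (IH Eb); rewrite /= fq.
Qed.

Lemma run_While_step F G tp tp1 t1 b tp2 t2 b' tp3 t3 :
  run (f0 F) tp true tp1 t1 -> run (f0 G) tp1 b tp2 t2 ->
  run (f0 (While F G)) tp2 b' tp3 t3 ->
  run (f0 (While F G)) tp b' tp3 (t1 + (t2 + t3)).
Proof.
rewrite /=; move Ec: true => c rF rG rW.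
have {rG rW} : @run (While F G) (inr (f0 G)) tp1 b' tp3 (t2 + t3).
  elim: rG rW => [q t d s m fq | q t q' s m d t' n fq _ IH] rW.
    by apply: run_step rW; rewrite /= fq.
  by apply: run_step (IH rW); rewrite /= fq.
elim: rF Ec => [q t d s m fq | q t q' s m d t' n fq _ IH] Ec rb.
  by apply: run_step rb; rewrite /= fq -Ec.
by apply: run_step (IH Ec rb); rewrite /= fq.
Qed.

(** * Fragments as Turing machines *)

Definition frag_TM (F : frag) : TM := {|
  tm_state := (fs F + bool)%type;
  tm_sym := sym;
  tm_blank := blank;
  tm_inp := fun b => (Some b, false, [ffun=> false]);
  tm_start := inl (f0 F);
  tm_halt := fun q => if q is inr _ then true else false;
  tm_acc := fun q => if q is inr b then b else false;
  tm_delta := fun q a =>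
    match q with inl q => fd q a | inr b => (inr b, a, Stay) end
|}.

Definition conf_of (F : frag) (q : fs F + bool) (tp : tape) :
  config (frag_TM F) := @Conf (frag_TM F) q tp.1.1 tp.1.2 tp.2.

Lemma step_put F (q : fs F) tp q' s m :
  fd q tp.1.2 = (q', s, m) ->
  tm_step (conf_of (inl q) tp) = conf_of q' (put s m tp).
Proof.
case: tp => [[l a] rr] /= fq; rewrite /tm_step /= fq.
by case: m {fq}; [case: l | case: rr |].
Qed.

Lemma run_iter F (q : fs F) tp b tp' t :
  run q tp b tp' t ->
  iter t (@tm_step _) (conf_of (inl q) tp) = conf_of (inr b) tp'.
Proof.
elim=> [{}q t0 c s m fq | {}q t0 q' s m c t' n fq _ IH].
  exact: step_put fq.
by rewrite iterSr (step_put fq).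
Qed.

(* The tape as a function on positions 0, 1, ...; the head never moves left of
   position 0. *)
Definition shows (tp : tape) (f : nat -> sym) (p : nat) : Prop :=
  let: (l, a, r) := tp in
  [/\ size l = p, forall i, i < p -> nth blank l i = f (p - i.+1),
      a = f p & forall i, nth blank r i = f (p + i.+1)].

Definition upd (T : Type) (f : nat -> T) (p : nat) (v : T) : nat -> T :=
  fun i => if i == p then v else f i.

Definition shift (m : move) (p : nat) : nat :=
  match m with MoveL => p.-1 | MoveR => p.+1 | Stay => p end.

Lemma shows_ext tp f g p : f =1 g -> shows tp f p -> shows tp g p.
Proof.
case: tp => [[l a] rr] fg [sl hl ha hr].
by split=> [|i ip||i]; rewrite // -fg //; apply: hl.
Qed.

Lemma shows_cur tp f p : shows tp f p -> tp.1.2 = f p.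
Proof. by case: tp => [[l a] rr] []. Qed.

(** A left move from position 0 would insert a new cell and renumber all others; the side condition
    excludes it. *)
Lemma shows_put tp f p s m :
  shows tp f p -> (if m is MoveL then 0 < p else true) ->
  shows (put s m tp) (upd f p s) (shift m p).
Proof.
case: tp => [[l a] rr] [sl hl ha hr]; case: m => /= hp.
- case: l sl hl => [|x l] /= sl hl; first by rewrite -sl in hp.
  split=> [|i ip||i].
  + by rewrite -sl.
  + rewrite /upd ifF; last by apply/eqP; lia.
    by have /= -> := hl i.+1; [congr f; lia | lia].
  + rewrite /upd ifF; last by apply/eqP; lia.
    by rewrite -(subn1 p) -(hl 0).
  + case: i => [|i] /=; rewrite /upd.
      by rewrite ifT //; apply/eqP; lia.
    rewrite ifF; last by apply/eqP; lia.
    by rewrite hr; congr f; lia.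
- have hl' i : i < p.+1 -> nth blank (s :: l) i = upd f p s (p.+1 - i.+1).
    case: i => [|i] ip /=; rewrite /upd; first by rewrite ifT //; apply/eqP; lia.
    by rewrite ifF ?hl //; apply/eqP; lia.
  case: rr hr => [|x rr] hr /=; (split; [by rewrite /= sl | by [] | |]).
  + rewrite /upd ifF; last by apply/eqP; lia.
    by have := hr 0; rewrite addn1.
  + move=> i; rewrite /upd ifF; last by apply/eqP; lia.
    by have:= hr i.+1; rewrite !nth_nil => ->; congr f; lia.
  + rewrite /upd ifF; last by apply/eqP; lia.
    by have := hr 0; rewrite addn1.
  + move=> i; rewrite /upd ifF; last by apply/eqP; lia.
    by have /= -> := hr i.+1; congr f; lia.
- split=> [//|i ip||i]; rewrite /upd ?eqxx //.
  + by rewrite ifF ?hl //; apply/eqP; lia.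
  + by rewrite ifF ?hr //; apply/eqP; lia.
Qed.

Definition marked (x : nat) (a : sym) : bool := a.2 (inord x).

Definition set_mark (x : nat) (b : bool) (a : sym) : sym :=
  (a.1, [ffun i => if i == inord x then b else a.2 i]).

(* Walk right to the mark of register x, act there, finish on the cell reached,
   and walk back to the left end, carrying the bit read by h. *)
Definition sweep (x : nat) (act : sym -> sym * move) (fin : sym -> sym)
    (h : sym -> bool) : frag :=
  @Frag (option (bool * bool)) None (fun q a =>
    match q with
    | None => if marked x a
              then (inl (Some (false, h a)), (act a).1, (act a).2)
              else (inl None, a, MoveR)
    | Some (false, b) => (inl (Some (true, b)), fin a, Stay)
    | Some (true, b) => if a.1.2 then (inr b, a, Stay)
                        else (inl (Some (true, b)), a, MoveL)
    end).

Definition test x h := sweep x (fun a => (a, Stay)) id h.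

(** Cell [N] is the first without an input bit. The mark stays there, so register values saturate at
    the input length. *)
Definition inc x := sweep x
  (fun a => if a.1.1 is Some _ then (set_mark x false a, MoveR) else (a, Stay))
  (set_mark x true) xpredT.

Definition dec x := sweep x
  (fun a => if a.1.2 then (a, Stay) else (set_mark x false a, MoveL))
  (set_mark x true) xpredT.

Definition reset x := While (test x (fun a => ~~ a.1.2)) (dec x).

Definition Seq F G := If F G G.

(** Every assignment has this form: starting from 0, the mark of [x] moves right until it reaches a
    cell satisfying [h]. *)
Definition climb x h := Seq (reset x) (While (test x (fun a => ~~ h a)) (inc x)).

Definition copy x y := climb x (marked y).

Definition init : frag :=
  @Frag unit tt (fun _ a => (inr true, (a.1.1, true, [ffun=> true]), Stay)).

(** * Execution on register states *)

Variable w : seq bool.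
Local Notation N := (size w).

Definition tape_of (s : nat -> nat) (i : nat) : sym :=
  (onth w i, i == 0, [ffun x : 'I_r.+1 => s x == i]).

(** The head starts and ends at position 0, which makes executions composable; [T] is only an upper
    bound on the number of steps. *)
Definition exec (F : frag) (s : nat -> nat) (b : bool) (s' : nat -> nat) (T : nat)
  : Prop :=
  forall tp, shows tp (tape_of s) 0 ->
  exists t tp', [/\ t <= T, run (f0 F) tp b tp' t & shows tp' (tape_of s') 0].

Lemma tape_of_ext s s' : s =1 s' -> tape_of s =1 tape_of s'.
Proof.
by move=> e i; congr (_, _, _); apply/ffunP => x; rewrite !ffunE e.
Qed.

Lemma exec_weaken F s b s1 s2 T1 T2 :
  exec F s b s1 T1 -> s1 =1 s2 -> T1 <= T2 -> exec F s b s2 T2.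
Proof.
move=> ex e le tp /ex [t [tp' [tT rF sh]]]; exists t, tp'; split=> //.
  exact: leq_trans le.
exact: shows_ext (tape_of_ext e) sh.
Qed.

Lemma exec_If F G H s b s1 T1 b' s2 T2 :
  exec F s b s1 T1 -> exec (if b then G else H) s1 b' s2 T2 ->
  exec (If F G H) s b' s2 (T1 + T2).
Proof.
move=> eF eG tp /eF [t1 [tp1 [le1 r1 /eG [t2 [tp2 [le2 r2 sh]]]]]].
exists (t1 + t2), tp2; split=> //; first exact: leq_add.
by apply: run_If r1 _; case: b {eF} eG r2.
Qed.

Lemma exec_Seq F G s b s1 T1 b' s2 T2 :
  exec F s b s1 T1 -> exec G s1 b' s2 T2 -> exec (Seq F G) s b' s2 (T1 + T2).
Proof. by move=> eF eG; apply: exec_If eF _; case: b. Qed.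

Lemma exec_While_exit F G s s1 T :
  exec F s false s1 T -> exec (While F G) s true s1 T.
Proof.
move=> eF tp /eF [t [tp' [le rF sh]]].
by exists t, tp'; split=> //; apply: run_While_exit.
Qed.

Lemma exec_While_step F G s s1 b s2 b' s3 T1 T2 T3 :
  exec F s true s1 T1 -> exec G s1 b s2 T2 -> exec (While F G) s2 b' s3 T3 ->
  exec (While F G) s b' s3 (T1 + (T2 + T3)).
Proof.
move=> eF eG eW tp /eF [t1 [tp1 [le1 r1]]] /eG [t2 [tp2 [le2 r2]]].
move=> /eW [t3 [tp3 [le3 r3 sh]]].
exists (t1 + (t2 + t3)), tp3; split=> //; first by rewrite !leq_add.
exact: run_While_step r1 r2 r3.
Qed.

Lemma inord_le x : x <= r -> (inord x : 'I_r.+1) = x :> nat.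
Proof. by move=> xr; rewrite inordK. Qed.

Lemma marked_tape x s i : x <= r -> marked x (tape_of s i) = (s x == i).
Proof. by move=> xr; rewrite /marked ffunE inord_le. Qed.

Lemma shows_stay tp f p m :
  shows tp f p -> (if m is MoveL then 0 < p else true) ->
  shows (put tp.1.2 m tp) f (shift m p).
Proof.
move=> sh hm; apply: shows_ext (shows_put tp.1.2 sh hm) => i.
by rewrite /upd (shows_cur sh); case: eqP => // ->.
Qed.

Lemma run_seek act fin h x s tp p :
  x <= r -> p <= s x -> shows tp (tape_of s) p ->
  exists2 tp1, shows tp1 (tape_of s) (s x) & forall b tp' t,
    @run (sweep x act fin h) None tp1 b tp' t ->
    @run (sweep x act fin h) None tp b tp' (s x - p + t).
Proof.
move=> xr; move En: (s x - p) => n.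
elim: n p En tp => [|n IH] p En tp ple sh.
  by exists tp => //; have <- : p = s x by lia.
have sh' := shows_stay (m := MoveR) sh isT.
case: (IH p.+1 _ (put tp.1.2 MoveR tp)) => [||//|tp1 sh1 k]; try by lia.
exists tp1 => // b tp' t /k; apply: run_step.
by rewrite /= (shows_cur sh) marked_tape // ifF //; apply/eqP; lia.
Qed.

Lemma run_back act fin h x b f tp p :
  (forall i, (f i).1.2 = (i == 0)) -> shows tp f p ->
  exists2 tp', shows tp' f 0 &
    @run (sweep x act fin h) (Some (true, b)) tp b tp' p.+1.
Proof.
move=> f0; elim: p tp => [|p IH] tp sh.
  exists (put tp.1.2 Stay tp); first exact: (shows_stay (m := Stay) sh).
  by apply: run_exit; rewrite /= (shows_cur sh) f0.
have [tp' sh' rn] := IH _ (shows_stay (m := MoveL) sh isT).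
exists tp' => //; apply: run_step rn.
by rewrite /= (shows_cur sh) f0.
Qed.

Lemma exec_sweep act fin h x s a m s' :
  x <= r -> act (tape_of s (s x)) = (a, m) ->
  let f := upd (tape_of s) (s x) a in
  let p' := shift m (s x) in
  (if m is MoveL then 0 < s x else true) ->
  upd f p' (fin (f p')) =1 tape_of s' ->
  exec (sweep x act fin h) s (h (tape_of s (s x))) s' (s x + p' + 3).
Proof.
move=> xr ea f p' hm ef tp sh.
have [tp1 sh1 k] := run_seek act fin h xr (leq0n _) sh.
have sh2 := shows_put a sh1 hm.
have sh3 := shows_ext ef (shows_put (fin (f p')) (m := Stay) sh2 isT).
have f0 i : (tape_of s' i).1.2 = (i == 0) by [].
have [tp' sh' rb] := run_back act fin h x (h (tape_of s (s x))) f0 sh3.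
(* The walk to the mark takes [s x] steps, [act] and [fin] one each, and the way back [p'.+1],
   including the exit. *)
exists (s x - 0 + p'.+3), tp'; split=> //; first by lia.
apply: k; apply: run_step.
  by rewrite /= (shows_cur sh1) marked_tape // eqxx ea.
apply: run_step rb.
by rewrite /= (shows_cur sh2).
Qed.

Definition bounded (s : nat -> nat) : Prop := forall x, s x <= N.

(** Bounds the time [s x + p' + 3] of a sweep, since [s x] is at most [n] and [p'] at most
    [n + 1]. *)
Definition unit_cost (n : nat) : nat := n + n + 4.

Lemma upd_bounded s x v : bounded s -> v <= N -> bounded (upd s x v).
Proof. by move=> bs vN y; rewrite /upd; case: ifP. Qed.

Lemma exec_test x h s :
  x <= r -> bounded s ->
  exec (test x h) s (h (tape_of s (s x))) s (unit_cost N).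
Proof.
move=> xr bs; apply: exec_weaken; first apply: exec_sweep => //=.
- by move=> i; rewrite /upd; case: eqP => // ->; rewrite eqxx.
- by [].
- by have := bs x; rewrite /unit_cost /=; lia.
Qed.

(** A sweep moves a mark in two halves: [act] clears it at the old cell and [fin] sets it at the new
    one. *)
Lemma set_mark_tape x s p v :
  x <= r -> p = s x ->
  upd (upd (tape_of s) p (set_mark x false (tape_of s p))) v
      (set_mark x true (upd (tape_of s) p (set_mark x false (tape_of s p)) v))
    =1 tape_of (upd s x v).
Proof.
move=> xr -> i.
have ix (j : 'I_r.+1) : (j == inord x) = (j == x :> nat).
  by rewrite -val_eqE /= inord_le.
have symP (a b : sym) : a.1 = b.1 -> a.2 =1 b.2 -> a = b.
  by case: a b => [a1 a2] [b1 b2] /= -> /ffunP ->.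
rewrite /tape_of /set_mark /upd; apply: symP => [|j].
  have [->|iv] := eqVneq i v; have [e|vx] := eqVneq v (s x); rewrite ?e //.
    by rewrite -e (negbTE iv).
  by case: (i =P s x) => [->|].
have [->|iv] := eqVneq i v; have [e|vx] := eqVneq v (s x); rewrite ?e /=.
- by rewrite !ffunE ix; case: (nat_of_ord j =P x) => //; rewrite eqxx.
- by rewrite !ffunE ix; case: (nat_of_ord j =P x) => //; rewrite eqxx.
- rewrite -e (negbTE iv) /= !ffunE; case: (nat_of_ord j =P x) => // ->.
  by rewrite e.
have [->|isx] := eqVneq i (s x); rewrite /= !ffunE ?ix;
  case: (nat_of_ord j =P x) => // jx; first by rewrite (negbTE vx).
by rewrite jx !(eq_sym _ i) (negbTE isx) (negbTE iv).
Qed.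

Lemma upd_id (T : Type) (s : nat -> T) x : upd s x (s x) =1 s.
Proof. by move=> i; rewrite /upd; case: eqP => // ->. Qed.

Lemma upd_upd (T : Type) (s : nat -> T) x a b : upd (upd s x a) x b =1 upd s x b.
Proof. by move=> i; rewrite /upd; case: eqP. Qed.

Lemma updE (T : Type) (s : nat -> T) x v : upd s x v x = v.
Proof. by rewrite /upd eqxx. Qed.

Lemma exec_inc x s :
  x <= r -> bounded s ->
  exec (inc x) s true (upd s x (minn (s x).+1 N)) (unit_cost N).
Proof.
move=> xr bs; have sN := bs x.
pose act (a : sym) := if a.1.1 is Some _ then (set_mark x false a, MoveR)
                      else (a, Stay).
have [e|e] := leqP N (s x).
  have ea : act (tape_of s (s x)) = (tape_of s (s x), Stay).
    by rewrite /act /= onth_default.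
  apply: exec_weaken;
  first apply: (@exec_sweep act (set_mark x true) xpredT _ _ _ _ s xr ea) => //=.
  - move=> i; rewrite /upd; case: eqP => // ->; rewrite eqxx /set_mark.
    congr (_, _); apply/ffunP => j; rewrite !ffunE.
    by case: (j =P _) => // ->; rewrite inord_le // eqxx.
  - by move=> j; rewrite -[LHS](upd_id s x); congr (upd s x _ j); lia.
  - by rewrite /unit_cost /=; lia.
have ea : act (tape_of s (s x)) =
    (set_mark x false (tape_of s (s x)), MoveR).
  by have := onthTE w (s x); rewrite e /act /=; case: (onth w (s x)).
apply: exec_weaken;
  first apply: (@exec_sweep act (set_mark x true) xpredT _ _ _ _ (upd s x (s x).+1) xr ea) => //=.
- exact: set_mark_tape.
- by move=> i; congr (upd s x _ i); lia.
- by rewrite /unit_cost /=; lia.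
Qed.

Lemma exec_dec x s :
  x <= r -> bounded s ->
  exec (dec x) s true (upd s x (s x).-1) (unit_cost N).
Proof.
move=> xr bs; have sN := bs x.
pose act (a : sym) := if a.1.2 then (a, Stay) else (set_mark x false a, MoveL).
have [e|e] := posnP (s x).
  have ea : act (tape_of s (s x)) = (tape_of s (s x), Stay).
    by rewrite /act /= e.
  apply: exec_weaken;
  first apply: (@exec_sweep act (set_mark x true) xpredT _ _ _ _ s xr ea) => //=.
  - move=> i; rewrite /upd; case: eqP => // ->; rewrite eqxx /set_mark.
    congr (_, _); apply/ffunP => j; rewrite !ffunE.
    by case: (j =P _) => // ->; rewrite inord_le // eqxx.
  - by move=> j; rewrite -[LHS](upd_id s x); congr (upd s x _ j); lia.
  - by rewrite /unit_cost /=; lia.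
have ea : act (tape_of s (s x)) = (set_mark x false (tape_of s (s x)), MoveL).
  by rewrite /act /= ifF //; apply/eqP; lia.
apply: exec_weaken;
  first apply: (@exec_sweep act (set_mark x true) xpredT _ _ _ _ (upd s x (s x).-1) xr ea) => //=.
- exact: set_mark_tape.
- by [].
- by rewrite /unit_cost /=; lia.
Qed.

(** At most [n] rounds of a test and a step, plus the last test, which is charged as a full
    round. *)
Definition loop_cost (n : nat) : nat := n.+1 * (unit_cost n + unit_cost n).

Lemma exec_reset x s :
  x <= r -> bounded s -> exec (reset x) s true (upd s x 0) (loop_cost N).
Proof.
move=> xr bs.
(* The induction is on the current value of [x], which is the number of rounds left. *)
suff H k s1 : bounded s1 -> s1 x = k ->
    exec (reset x) s1 true (upd s1 x 0) (k.+1 * (unit_cost N + unit_cost N)).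
  apply: exec_weaken; [exact: (H (s x) s bs erefl) | exact: frefl |].
  by rewrite leq_mul2r ltnS bs orbT.
elim: k s1 => [|k IH] s1 bs1 e.
  apply: (exec_weaken (s1 := s1) (T1 := unit_cost N)); last by lia.
    apply: exec_While_exit.
    by have := exec_test (fun a => ~~ a.1.2) xr bs1; rewrite /= e eqxx.
  by move=> i; rewrite -[LHS](upd_id s1 x) e.
apply: exec_weaken; first apply: (exec_While_step (s1 := s1)).
- by have := exec_test (fun a => ~~ a.1.2) xr bs1; rewrite /= e; apply.
- exact: exec_dec.
- apply: IH; last by rewrite updE e.
  by apply: upd_bounded => //; have := bs1 x; lia.
- exact: upd_upd.
- by rewrite [k.+2 * _]mulSn addnA.
Qed.

(** Since [h] may read marks, and the mark of [x] moves with the climb, [h] is evaluated at cell [i]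
    on the tape where [x] already has value [i]. *)
Lemma exec_climb x h v s :
  x <= r -> bounded s -> v <= N ->
  (forall i, i <= v -> h (tape_of (upd s x i) i) = (i == v)) ->
  exec (climb x h) s true (upd s x v) (loop_cost N + loop_cost N).
Proof.
move=> xr bs vN hv.
(* Here [k] is the distance still to climb. *)
suff H k s1 : bounded s1 -> s1 =1 upd s x (v - k) -> k <= v ->
    exec (While (test x (fun a => ~~ h a)) (inc x)) s1 true (upd s x v)
      (k.+1 * (unit_cost N + unit_cost N)).
  apply: exec_Seq; first exact: exec_reset.
  apply: exec_weaken.
  - by apply: (H v) => //; [apply: upd_bounded | rewrite subnn].
  - by [].
  - by rewrite leq_mul2r ltnS vN orbT.
elim: k s1 => [|k IH] s1 bs1 e kv.
  apply: (exec_weaken (s1 := s1) (T1 := unit_cost N)); last by lia.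
    apply: exec_While_exit.
    have := exec_test (fun a => ~~ h a) xr bs1.
    by rewrite (tape_of_ext e) e updE hv ?leq_subr // subn0 eqxx.
  by move=> i; rewrite e subn0.
apply: exec_weaken; first apply: (exec_While_step (s1 := s1)).
- have := exec_test (fun a => ~~ h a) xr bs1.
  rewrite (tape_of_ext e) e updE hv ?leq_subr //.
  have -> : (v - k.+1 == v) = false by apply/eqP; lia.
  exact.
- exact: exec_inc.
- apply: (IH _ _ _ (ltnW kv)); first by apply: upd_bounded => //; lia.
  move=> i; rewrite /upd e; case: eqP => [_|ix]; last by rewrite e /upd; case: eqP.
  by rewrite updE; lia.
- by [].
- by rewrite [k.+2 * _]mulSn addnA.
Qed.

(** The registers must differ, as the climb begins by resetting [x]. *)
Lemma exec_copy x y s :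
  x <= r -> y <= r -> x != y -> bounded s ->
  exec (copy x y) s true (upd s x (s y)) (loop_cost N + loop_cost N).
Proof.
move=> xr yr xy bs; apply: exec_climb => // i iy.
by rewrite marked_tape // /upd (eq_sym y x) (negbTE xy) eq_sym.
Qed.

Lemma exec_top x s :
  x <= r -> bounded s ->
  exec (climb x (fun a => ~~ a.1.1)) s true (upd s x N)
    (loop_cost N + loop_cost N).
Proof.
move=> xr bs; apply: exec_climb => // i iN.
by rewrite /= onthTE; lia.
Qed.

End Fragments.

(** * Bounded-loop expressions *)

Inductive expr :=
| Var of nat
| Zero
| Top
| Inc of expr
| Dec of expr
| IfBit of expr & expr & expr
| IfEq of expr & expr & expr & expr
| Let of expr & expr
| Iter of expr & expr & expr.

Fixpoint loop (f : nat -> nat -> nat) (n acc : nat) : nat :=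
  if n is k.+1 then loop f k (f k acc) else acc.

(* Variables are de Bruijn indices; the body of Iter sees the accumulator as
   variable 0 and the index, which runs downwards, as variable 1. *)
Fixpoint eval (w : seq bool) (env : seq nat) (e : expr) : nat :=
  match e with
  | Var i => nth 0 env i
  | Zero => 0
  | Top => size w
  | Inc e => minn (eval w env e).+1 (size w)
  | Dec e => (eval w env e).-1
  | IfBit e e1 e2 =>
      if nth false w (eval w env e) then eval w env e1 else eval w env e2
  | IfEq a b e1 e2 =>
      if eval w env a == eval w env b then eval w env e1 else eval w env e2
  | Let a b => eval w (eval w env a :: env) b
  | Iter n a b =>
      loop (fun k acc => eval w (acc :: k :: env) b) (eval w env n) (eval w env a)
  end.

(** With target register [d], the compiled code of [e] stays within the registers [d] to
    [d + width e]. *)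
Fixpoint width (e : expr) : nat :=
  match e with
  | Var _ | Zero | Top => 0
  | Inc e | Dec e => width e
  | IfBit e e1 e2 => maxn (width e) (maxn (width e1) (width e2))
  | IfEq a b e1 e2 =>
      maxn (width a) (maxn (width b).+1 (maxn (width e1) (width e2)))
  | Let a b => maxn (width a) (width b).+1
  | Iter n a b => maxn (width n) (maxn (width a).+1 (width b).+2)
  end.

Fixpoint cost (e : expr) (n : nat) : nat :=
  match e with
  | Var _ | Zero | Top => loop_cost n + loop_cost n
  | Inc e | Dec e => cost e n + unit_cost n
  | IfBit e e1 e2 => cost e n + (unit_cost n + (cost e1 n + cost e2 n))
  | IfEq a b e1 e2 =>
      cost a n + (cost b n + (unit_cost n + (cost e1 n + cost e2 n)))
  | Let a b => cost a n + (cost b n + (loop_cost n + loop_cost n))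
  | Iter m a b =>
      cost m n + (cost a n +
        (n.+1 * (unit_cost n + (unit_cost n + (cost b n +
           (loop_cost n + loop_cost n)))) + (loop_cost n + loop_cost n)))
  end.

(** The base [n.+1] is positive, so its powers grow with the exponent even at [n = 0]; this makes
    the closure properties uniform. *)
Definition polynomial (T : nat -> nat) : Prop :=
  exists c d, forall n, T n <= c * n.+1 ^ d.

Lemma polynomial_const k : polynomial (fun=> k).
Proof. by exists k, 0 => n; rewrite expn0 muln1. Qed.

Lemma polynomial_id : polynomial id.
Proof. by exists 1, 1 => n; rewrite expn1 mul1n. Qed.

Lemma polynomial_add S T :
  polynomial S -> polynomial T -> polynomial (fun n => S n + T n).
Proof.
move=> [c [d hS]] [c' [d' hT]]; exists (c + c'), (d + d') => n.
rewrite mulnDl leq_add //.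
  by apply: leq_trans (hS n) _; rewrite leq_mul2l leq_pexp2l ?leq_addr ?orbT.
by apply: leq_trans (hT n) _; rewrite leq_mul2l leq_pexp2l ?leq_addl ?orbT.
Qed.

Lemma polynomial_mul S T :
  polynomial S -> polynomial T -> polynomial (fun n => S n * T n).
Proof.
move=> [c [d hS]] [c' [d' hT]]; exists (c * c'), (d + d') => n.
by rewrite expnD mulnACA leq_mul.
Qed.

Lemma polynomial_cost e : polynomial (cost e).
Proof.
have p1 : polynomial unit_cost.
  apply: polynomial_add (polynomial_const 4).
  by apply: polynomial_add; exact: polynomial_id.
have pS : polynomial succn.
  by apply: polynomial_add (polynomial_const 1) polynomial_id.
have p2 : polynomial (fun n => loop_cost n + loop_cost n).
  by apply: polynomial_add; apply: polynomial_mul => //; apply: polynomial_add.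
by elim: e => /= *; do ?[assumption | apply: polynomial_mul | apply: polynomial_add].
Qed.

(** * Compilation of expressions to fragments *)

Section Compile.

Variable r : nat.

(** [rho] gives the register of each de Bruijn variable and [d] is the target; larger registers are
    scratch space. In [Iter] the counter is [d], the accumulator [d.+1], and [d.+2] receives the
    value of the body. *)
Fixpoint comp (e : expr) (rho : seq nat) (d : nat) : frag r :=
  match e with
  | Var i => if i < size rho then copy r d (nth 0 rho i) else reset r d
  | Zero => reset r d
  | Top => climb d (fun a => ~~ a.1.1)
  | Inc e => Seq (comp e rho d) (inc r d)
  | Dec e => Seq (comp e rho d) (dec r d)
  | IfBit e e1 e2 =>
      Seq (comp e rho d)
        (If (test d (fun a => a.1.1 == Some true))
           (comp e1 rho d) (comp e2 rho d))
  | IfEq a b e1 e2 =>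
      Seq (comp a rho d) (Seq (comp b rho d.+1)
        (If (test d (marked d.+1)) (comp e1 rho d) (comp e2 rho d)))
  | Let a b =>
      Seq (comp a rho d) (Seq (comp b (d :: rho) d.+1) (copy r d d.+1))
  | Iter n a b =>
      Seq (comp n rho d) (Seq (comp a rho d.+1)
        (Seq (While (test d (fun a => ~~ a.1.2))
                (Seq (dec r d) (Seq (comp b [:: d.+1, d & rho] d.+2)
                   (copy r d.+1 d.+2))))
           (copy r d d.+1)))
  end.

Variable w : seq bool.
Local Notation N := (size w).

(** Scratch registers end with unspecified values, so the final state is described by a
    predicate. *)
Definition ensures (F : frag r) (s : nat -> nat) (T : nat)
    (Q : (nat -> nat) -> Prop) : Prop :=
  exists b s', [/\ exec w F s b s' T, bounded w s' & Q s'].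

Lemma ensures_seq F G s P Q T T' :
  ensures F s T P ->
  (forall s', bounded w s' -> P s' -> ensures G s' T' Q) ->
  ensures (Seq F G) s (T + T') Q.
Proof.
move=> [b [s1 [e1 bs1 p1]]] /(_ s1 bs1 p1) [b' [s2 [e2 bs2 p2]]].
by exists b', s2; split=> //; apply: exec_Seq e1 e2.
Qed.

Lemma ensures_if F G H s b Q T T' :
  exec w F s b s T -> ensures (if b then G else H) s T' Q ->
  ensures (If F G H) s (T + T') Q.
Proof.
move=> eF [b' [s2 [e2 bs2 q2]]]; exists b', s2; split=> //.
exact: exec_If eF e2.
Qed.

Lemma ensures_upd F s d v T (Q : (nat -> nat) -> Prop) :
  exec w F s true (upd s d v) T -> bounded w s -> v <= N -> Q (upd s d v) ->
  ensures F s T Q.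
Proof.
by move=> eF bs vN q; exists true, (upd s d v); split=> //; apply: upd_bounded.
Qed.

Lemma ensures_weaken F s T T' (P Q : (nat -> nat) -> Prop) :
  ensures F s T P -> T <= T' -> (forall s', P s' -> Q s') -> ensures F s T' Q.
Proof.
move=> [b [s1 [e1 bs p]]] TT PQ; exists b, s1; split=> //; last exact: PQ.
exact: exec_weaken e1 _ TT.
Qed.

Lemma upd_neq (s : nat -> nat) d v i : i != d -> upd s d v i = s i.
Proof. by rewrite /upd => /negbTE ->. Qed.

Lemma map_frame (s s' : nat -> nat) rho d :
  all (gtn d) rho -> (forall i, i < d -> s' i = s i) -> map s' rho = map s rho.
Proof. by move=> /allP ha fr; apply/eq_in_map => i /ha /fr. Qed.

Lemma all_gtnW d d' rho : d <= d' -> all (gtn d) rho -> all (gtn d') rho.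
Proof. by move=> dd; apply: sub_all => i /= id; lia. Qed.

(** The second half is the frame condition: all variables live below [d] and must survive. *)
Definition holds_value (s : nat -> nat) (d v : nat) (s' : nat -> nat) : Prop :=
  s' d = v /\ forall i, i < d -> s' i = s i.

Lemma ensures_value F s s1 d v T :
  (forall i, i < d -> s1 i = s i) ->
  exec w F s1 true (upd s1 d v) T -> bounded w s1 -> v <= N ->
  ensures F s1 T (holds_value s d v).
Proof.
move=> fr eF bs vN; apply: ensures_upd eF bs vN _; split; first exact: updE.
by move=> i id; rewrite upd_neq ?fr //; lia.
Qed.

Lemma comp_correct e rho d s :
  d + width e <= r -> all (gtn d) rho -> bounded w s ->
  ensures (comp e rho d) s (cost e N) (holds_value s d (eval w (map s rho) e)).
Proof.
elim: e rho d s => [i|||e IH|e IH|e IH e1 IH1 e2 IH2|a IHa b IHb e1 IH1 e2 IH2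
  |a IHa b IHb|n IHn a IHa b IHb] rho d s /= wr ha bs.
- case: ifP => ir; last first.
    rewrite nth_default ?size_map 1?leqNgt ?ir //.
    apply: (ensures_weaken (T := loop_cost N) (P := holds_value s d 0)) => //;
      last exact: leq_addr.
    by apply: ensures_value => //; apply: exec_reset => //; lia.
  have id : nth 0 rho i < d by apply: (allP ha); apply: mem_nth.
  rewrite (nth_map 0) //; apply: ensures_value => //.
  by apply: exec_copy => //; lia.
- apply: (ensures_weaken (T := loop_cost N) (P := holds_value s d 0)) => //;
      last exact: leq_addr.
  by apply: ensures_value => //; apply: exec_reset => //; lia.
- by apply: ensures_value => //; apply: exec_top => //; lia.
- apply: ensures_seq (IH rho d s wr ha bs) _ => // s1 bs1 [<- fr].
  apply: ensures_value => //; last lia.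
  by apply: exec_inc => //; lia.
- apply: ensures_seq (IH rho d s wr ha bs) _ => // s1 bs1 [<- fr].
  apply: ensures_value => //; last by have := bs1 d; lia.
  by apply: exec_dec => //; lia.
- apply: ensures_seq (IH rho d s _ ha bs) _ => [|s1 bs1 [<- fr]]; first lia.
  apply: ensures_if; first by apply: exec_test => //; lia.
  (* A cell past the input carries [None], matching the default [false] of [nth]. *)
  have -> : ((tape_of r w s1 (s1 d)).1.1 == Some true) = nth false w (s1 d).
    by rewrite -odflt_onth /=; case: (onth w (s1 d)) => [[]|].
  have mf := map_frame ha fr; case: ifP => _.
    apply: ensures_weaken (IH1 rho d s1 _ ha bs1) _ _; [lia|lia|].
    by rewrite mf => s' [e' fr']; split=> // i id; rewrite fr' ?fr.
  apply: ensures_weaken (IH2 rho d s1 _ ha bs1) _ _; [lia|lia|].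
  by rewrite mf => s' [e' fr']; split=> // i id; rewrite fr' ?fr.
- apply: ensures_seq (IHa rho d s _ ha bs) _ => [|s1 bs1 [<- fr]]; first lia.
  have mf := map_frame ha fr.
  apply: ensures_seq (IHb rho d.+1 s1 _ (all_gtnW (leqnSn d) ha) bs1) _ => //.
    by lia.
  rewrite mf => s2 bs2 [<- fr2]; rewrite -(fr2 d) //.
  apply: ensures_if; first by apply: exec_test => //; lia.
  rewrite marked_tape; last lia.
  have fr3 i : i < d -> s2 i = s i by move=> id; rewrite fr2 ?fr //; lia.
  rewrite eq_sym; have mf3 := map_frame ha fr3; case: ifP => _.
    apply: ensures_weaken (IH1 rho d s2 _ ha bs2) _ _; [lia|lia|].
    by rewrite mf3 => s' [e' fr']; split=> // i id; rewrite fr' ?fr3.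
  apply: ensures_weaken (IH2 rho d s2 _ ha bs2) _ _; [lia|lia|].
  by rewrite mf3 => s' [e' fr']; split=> // i id; rewrite fr' ?fr3.
- apply: ensures_seq (IHa rho d s _ ha bs) _ => [|s1 bs1 [e1 fr]]; first lia.
  rewrite -e1 -(map_frame ha fr) -[s1 d :: _]/(map s1 (d :: rho)).
  apply: ensures_seq (IHb (d :: rho) d.+1 s1 _ _ bs1) _; [lia| |].
    by rewrite /= ltnSn (all_gtnW (leqnSn d)).
  move=> s2 bs2 [<- fr2]; apply: ensures_value => //.
    by move=> i id; rewrite fr2 ?fr //; lia.
  by apply: exec_copy => //; lia.
- apply: ensures_seq (IHn rho d s _ ha bs) _ => [|s1 bs1 [<- fr1]]; first lia.
  apply: ensures_seq (IHa rho d.+1 s1 _ (all_gtnW (leqnSn d) ha) bs1) _ => //.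
    by lia.
  rewrite (map_frame ha fr1) => s2 bs2 [<- fr2]; rewrite -(fr2 d) //.
  pose f k acc := eval w [:: acc, k & map s rho] b; rewrite -/f.
  have {fr2} fr2 i : i < d -> s2 i = s i by move=> id; rewrite fr2 ?fr1 //; lia.
  apply: (ensures_seq (P := fun s' => s' d.+1 = loop f (s2 d) (s2 d.+1) /\
    forall i, i < d -> s' i = s i)); last first.
    move=> s3 bs3 [<- fr3]; apply: ensures_value => //.
    by apply: exec_copy => //; lia.
  set K := unit_cost N + _; set W := While _ _.
  (* Induction on the counter [k], for an arbitrary accumulator in [d.+1]; [K] bounds one round. *)
  suff H k s3 : bounded w s3 -> s3 d = k -> (forall i, i < d -> s3 i = s i) ->
      exists s', [/\ exec w W s3 true s' (k.+1 * K), bounded w s',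
        s' d.+1 = loop f k (s3 d.+1) & forall i, i < d -> s' i = s i].
    have [s' [ex bs' e' fr']] := H _ s2 bs2 erefl fr2.
    exists true, s'; split=> //; apply: exec_weaken ex _ _ => //.
    by rewrite leq_mul2r ltnS bs2 orbT.
  have td s' : bounded w s' ->
      exec w (test (r := r) d (fun a => ~~ a.1.2)) s' (0 < s' d) s' (unit_cost N).
    move=> bs'; have := exec_test (fun a : sym r => ~~ a.1.2) _ bs'.
    by rewrite lt0n /=; apply; lia.
  elim: k s3 => [|k IH] s3 bs3 e3 fr3.
    exists s3; split=> //.
    apply: (exec_weaken (T1 := unit_cost N) (s1 := s3)) => //.
      by apply: exec_While_exit; have := td s3 bs3; rewrite e3.
    by rewrite mul1n leq_addr.
  have wd : d <= r by lia.
  (* The counter is decremented before the body runs, so the body sees the index [k] while the round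
     starts with [k.+1]. *)
  have body : ensures (Seq (dec r d) (Seq (comp b [:: d.+1, d & rho] d.+2)
       (copy r d.+1 d.+2))) s3
     (unit_cost N + (cost b N + (loop_cost N + loop_cost N)))
     (fun s' => [/\ s' d = k, s' d.+1 = f k (s3 d.+1) &
        forall i, i < d -> s' i = s i]).
    apply: (ensures_seq (P := fun s' => s' =1 upd s3 d k)).
      apply: ensures_upd; [exact: exec_dec | by [] | |].
        by have := bs3 d; lia.
      by rewrite e3.
    move=> s4 bs4 e4.
    have fr4 i : i < d -> s4 i = s i.
      by move=> id; rewrite e4 upd_neq ?fr3 //; lia.
    apply: ensures_seq (IHb [:: d.+1, d & rho] d.+2 s4 _ _ bs4) _; first lia.
      by rewrite /= !ltnS leqnn leqnSn /= (all_gtnW _ ha) //; lia.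
    move=> s5 bs5 [e5 fr5]; apply: ensures_upd;
      [by apply: exec_copy => //; lia | by []..| ].
    split.
    - by rewrite upd_neq ?fr5 ?e4 ?updE //; lia.
    - rewrite updE e5 /f /= (map_frame ha fr4) !e4 updE upd_neq //; lia.
    - by move=> i id; rewrite upd_neq ?fr5 ?fr4 //; lia.
  have [c [s4 [ex4 bs4 [e4 e4' fr4]]]] := body.
  have [s5 [ex5 bs5 e5 fr5]] := IH s4 bs4 e4 fr4.
  exists s5; split=> //; last by rewrite e5 e4'.
  have -> : k.+2 * K = unit_cost N +
      ((unit_cost N + (cost b N + (loop_cost N + loop_cost N))) + k.+1 * K).
    by rewrite [k.+2 * _]mulSn /K !addnA.
  by apply: exec_While_step ex4 ex5; have := td s3 bs3; rewrite e3.
Qed.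

End Compile.

(** For positive [n], [n.+1 <= 2 * n] yields the factor [2 ^ d]; the additive constant covers
    [n = 0]. *)
Lemma poly_time_bound T :
  polynomial T -> exists c d, forall n, T n <= c * n ^ d + c.
Proof.
move=> [c [d h]]; exists (c * 2 ^ d), d => n; apply: leq_trans (h n) _.
case: n => [|n].
  by apply: leq_trans (leq_addl _ _); rewrite exp1n leq_mul2l expn_gt0 orbT.
apply: leq_trans (leq_addr _ _); rewrite -mulnA -expnMn leq_mul2l.
by case: d {h} => [|d]; rewrite ?expn0 ?orbT // leq_exp2r ?orbT //; lia.
Qed.

(** The machine marks the left end with all registers at 0, evaluates [e] into register 0, and
    accepts iff that mark has left the first cell. *)
Lemma eval_TM (e : expr) :
  exists (M : TM) (c d : nat), forall w, exists t,
    [/\ t <= c * size w ^ d + c, tm_halt (cstate (tm_run M t w))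
      & tm_acc (cstate (tm_run M t w)) = (0 < eval w [::] e)].
Proof.
pose r := width e.
pose body := Seq (comp r e [::] 0) (test 0 (fun a => ~~ a.1.2)).
pose F := Seq (init r) body.
have [c [d hT]] : exists c d, forall n,
    1 + (cost e n + unit_cost n) <= c * n ^ d + c.
  apply: poly_time_bound; apply: polynomial_add (polynomial_const 1) _.
  apply: polynomial_add; first exact: polynomial_cost.
  apply: polynomial_add (polynomial_const 4).
  by apply: polynomial_add; exact: polynomial_id.
exists (frag_TM F), c, d => w.
have [tp e0 sh0] : exists2 tp, tm_init (frag_TM F) w = conf_of (inl (f0 F)) tp
   & shows tp (fun i => (onth w i, false, [ffun=> false])) 0.
  rewrite /tm_init; set g := tm_inp _.
  have hr v i : nth (blank r) (map g v) i = (onth v i, false, [ffun=> false]).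
    by elim: v i => [|b v IH] [|i] //=; rewrite ?nth_nil // onth0n.
  case: w => [|b w] /=.
    exists ([::], blank r, [::]) => //; split=> // i.
    by rewrite nth_nil onth0n.
  by exists ([::], g b, map g w) => //; split=> // i; rewrite hr.
pose s0 : nat -> nat := fun=> 0.
have bs0 : bounded w s0 by [].
have sh1 : shows (put (tp.1.2.1.1, true, [ffun=> true]) Stay tp) (tape_of r w s0) 0.
  have := shows_put (tp.1.2.1.1, true, [ffun=> true]) (m := Stay) sh0 isT.
  apply: shows_ext => i; rewrite /upd (shows_cur sh0) /tape_of.
  case: eqP => [->|/eqP i0] /=; congr (_, _, _).
  by apply/ffunP => x; rewrite !ffunE eq_sym (negbTE i0).
have [b [s1 [ex1 bs1 [e1 _]]]] : ensures w (comp r e [::] 0) s0 (cost e (size w))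
    (holds_value s0 0 (eval w [::] e)) by exact: comp_correct.
have ex2 := exec_test (fun a : sym r => ~~ a.1.2) (leq0n r) bs1.
have [t [tp' [tT rn _]]] := exec_Seq ex1 ex2 sh1.
have ri : run (f0 (init r)) tp true
    (put (tp.1.2.1.1, true, [ffun=> true]) Stay tp) 1 by exact: run_exit.
have rF : run (f0 F) tp _ tp' (1 + t) := run_If (G := body) (H := body) ri rn.
exists (1 + t); rewrite /tm_run e0 (run_iter rF) /= e1 lt0n; split=> //.
by apply: leq_trans (hT _); rewrite leq_add2l.
Qed.

(** * Reading the tokens of the input *)

Definition add (a b : expr) : expr := Iter b a (Inc (Var 0)).
Definition sub (a b : expr) : expr := Iter b a (Dec (Var 0)).
Definition One : expr := Inc Zero.

(** [p + 2 * k]: where digit pair [k] of the token starting at position [p] begins. *)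
Definition offset (p k : expr) : expr := add p (add k k).

(** The counter advances while it sees the marker bit of a digit pair and stalls at the terminator,
    so [Top] rounds are enough. *)
Definition bit_length (e : expr) : expr :=
  Let e (Iter Top Zero (IfBit (offset (Var 2) (Var 0)) (Inc (Var 0)) (Var 0))).

Definition skip_token (e : expr) : expr :=
  Let e (Inc (Inc (offset (Var 0) (bit_length (Var 0))))).

Definition position (e : expr) : expr := Iter e Zero (skip_token (Var 0)).

(** Horner evaluation: digits are stored least significant first, and the downward index visits them
    from the most significant. *)
Definition token (e : expr) : expr :=
  Let (position e) (Iter (bit_length (Var 0)) Zero
    (IfBit (Inc (offset (Var 2) (Var 1)))
       (Inc (add (Var 0) (Var 0))) (add (Var 0) (Var 0)))).

(** Candidates are written in binary and may exceed the input length, beyond what a register holds.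
    They are therefore compared digit by digit and never evaluated. *)
Definition same_token (i j : nat) : expr :=
  Let (position (Var i)) (Let (position (Var j.+1))
    (IfEq (bit_length (Var 1)) (bit_length (Var 0))
       (Iter (bit_length (Var 0)) One
          (IfBit (Inc (offset (Var 3) (Var 1)))
             (IfBit (Inc (offset (Var 2) (Var 1))) (Var 0) Zero)
             (IfBit (Inc (offset (Var 2) (Var 1))) Zero (Var 0))))
       Zero)).

(** In an invariant [P k acc], [k] counts the remaining rounds; the indices from [k] up have been
    processed. *)
Lemma loop_ind (P : nat -> nat -> Prop) f n a :
  P n a -> (forall k acc, k < n -> P k.+1 acc -> P k (f k acc)) ->
  P 0 (loop f n a).
Proof.
elim: n a => [|n IH] a //= Pa Pf; apply: IH; first exact: Pf.
by move=> k acc kn; apply: Pf; apply: ltnW.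
Qed.

Lemma loop_has (p : pred nat) f n :
  (forall k acc, k < n -> acc <= 1 -> f k acc = if p k then 1 else acc) ->
  loop f n 0 = has p (iota 0 n).
Proof.
move=> hf; pose P (k acc : nat) := acc = has p (iota k (n - k)) :> nat.
have : P 0 (loop f n 0).
  apply: loop_ind => [|k acc kn]; rewrite /P; first by rewrite subnn.
  by move=> ->; rewrite hf ?leq_b1 // -[n - k]prednK /= ?subn_gt0 // subnS;
     case: (p k).
by rewrite /P subn0.
Qed.

Lemma loop_all (p : pred nat) f n :
  (forall k acc, k < n -> acc <= 1 -> f k acc = if p k then acc else 0) ->
  loop f n 1 = all p (iota 0 n).
Proof.
move=> hf; pose P (k acc : nat) := acc = all p (iota k (n - k)) :> nat.
have : P 0 (loop f n 1).
  apply: loop_ind => [|k acc kn]; rewrite /P; first by rewrite subnn.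
  by move=> ->; rewrite hf ?leq_b1 // -[n - k]prednK /= ?subn_gt0 // subnS;
     case: (p k).
by rewrite /P subn0.
Qed.

(** The bound [acc < n], available before each round, lets callers show that [Inc] does not
    saturate. *)
Lemma loop_count (p : pred nat) f n :
  (forall k acc, k < n -> acc < n -> f k acc = if p k then acc.+1 else acc) ->
  loop f n 0 = count p (iota 0 n).
Proof.
move=> hf; pose P (k acc : nat) := acc = count p (iota k (n - k)).
have : P 0 (loop f n 0).
  apply: loop_ind => [|k acc kn]; rewrite /P; first by rewrite subnn.
  move=> e; rewrite hf //; last first.
    by rewrite e (leq_ltn_trans (count_size _ _)) // size_iota; lia.
  by rewrite e -[n - k]prednK /= ?subn_gt0 // subnS; case: (p k).
by rewrite /P subn0.
Qed.

Lemma eval_add w env a b :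
  eval w env a <= size w ->
  eval w env (add a b) = minn (eval w env a + eval w env b) (size w).
Proof.
rewrite /add /=; elim: (eval w env b) (eval w env a) => [|n IH] m mN /=.
  by rewrite addn0; apply/esym/minn_idPl.
by rewrite IH ?geq_minr //; lia.
Qed.

Lemma eval_sub w env a b :
  eval w env (sub a b) = eval w env a - eval w env b.
Proof.
rewrite /sub /=; elim: (eval w env b) (eval w env a) => [|n IH] m /=.
  by rewrite subn0.
by rewrite IH; lia.
Qed.

(* Keeps simplification of [eval] from unfolding composite expressions. *)
#[global] Opaque add sub.

Lemma eval_offset w env p k :
  eval w env p <= size w ->
  eval w env k <= size w ->
  eval w env (offset p k) =
    minn (eval w env p + (eval w env k + eval w env k)) (size w).
Proof. by move=> hp hk; rewrite !eval_add //; lia. Qed.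

#[global] Opaque offset.

Definition bits_value (bs : seq bool) : nat :=
  foldr (fun (b : bool) v => b + v.*2) 0 bs.

Lemma bits_valueK n : bits_value (nat_bits n) = n.
Proof.
rewrite -[RHS]bin_of_natK /nat_bits; case: (bin_of_nat n) => // p /=.
elim: p => [p IH|p IH|//] /=; rewrite IH.
  by rewrite /= NatTrec.doubleE.
by rewrite NatTrec.doubleE.
Qed.

(** Partial Horner values never exceed the final one, so a token of value at most [N] is computed
    without saturation. *)
Lemma bits_value_drop k bs : bits_value (drop k bs) <= bits_value bs.
Proof. by elim: bs k => [|b bs IH] [|k] //=; have := IH k; lia. Qed.

(** * Token boundaries in the encoded word *)

Section Tokens.

Variable T : seq nat.
Let w := flatten (map enc_nat T).
Local Notation N := (size w).

Definition start (j : nat) : nat := size (flatten (map enc_nat (take j T))).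

Lemma size_enc n : size (enc_nat n) = (size (nat_bits n)).*2.+2.
Proof.
rewrite /enc_nat size_cat /=; elim: (nat_bits n) => //= b bs; lia.
Qed.

Lemma nth_enc n t : t < size (nat_bits n) ->
  nth false (enc_nat n) (t + t) = true /\
  nth false (enc_nat n) (t + t).+1 = nth false (nat_bits n) t.
Proof.
rewrite /enc_nat; elim: (nat_bits n) t => //= b bs IH [|t] //= tb.
by rewrite addnS; apply: IH.
Qed.

Lemma nth_enc_end n :
  nth false (enc_nat n) (size (nat_bits n) + size (nat_bits n)) = false.
Proof. by rewrite /enc_nat; elim: (nat_bits n) => //= b bs IH; rewrite addnS. Qed.

Lemma startS j : j < size T ->
  start j.+1 = start j + (size (nat_bits (nth 0 T j))).*2.+2.
Proof.
move=> jT; rewrite /start (take_nth 0 jT) map_rcons flatten_rcons size_cat.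
by rewrite size_enc.
Qed.

Lemma start_size : start (size T) = N.
Proof. by rewrite /start take_size. Qed.

Lemma start_le j : j <= size T -> start j <= N.
Proof.
move=> jT; rewrite /start /w -{2}(cat_take_drop j T) map_cat flatten_cat.
by rewrite size_cat leq_addr.
Qed.

Lemma le_start j : j <= size T -> j <= start j.
Proof.
by elim: j => // j IH jT; rewrite startS //; have := IH (ltnW jT); lia.
Qed.

Lemma size_tokens : size T <= N.
Proof. by rewrite -start_size le_start. Qed.

Lemma nth_token j i : j < size T -> i < size (enc_nat (nth 0 T j)) ->
  nth false w (start j + i) = nth false (enc_nat (nth 0 T j)) i.
Proof.
move=> jT ie; rewrite /w -{1}(cat_take_drop j T) (drop_nth 0 jT).
rewrite map_cat flatten_cat nth_cat ifF; last by rewrite /start; lia.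
by rewrite /start addKn /= nth_cat ie.
Qed.

Lemma nth_marker j t : j < size T -> t <= size (nat_bits (nth 0 T j)) ->
  nth false w (start j + (t + t)) = (t < size (nat_bits (nth 0 T j))).
Proof.
move=> jT; rewrite leq_eqVlt => /orP[/eqP ->|tb].
  by rewrite nth_token ?nth_enc_end ?ltnn // size_enc; lia.
by rewrite nth_token ?(nth_enc tb).1 ?tb // size_enc; lia.
Qed.

Lemma nth_bit j t : j < size T -> t < size (nat_bits (nth 0 T j)) ->
  nth false w (start j + (t + t)).+1 = nth false (nat_bits (nth 0 T j)) t.
Proof.
move=> jT tb; rewrite -addnS nth_token ?(nth_enc tb).2 // size_enc; lia.
Qed.

Lemma token_end j : j < size T ->
  start j + (size (nat_bits (nth 0 T j))).*2.+2 <= N.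
Proof. by move=> jT; rewrite -startS // start_le. Qed.

Lemma eval_bit_length env e j : eval w env e = start j -> j < size T ->
  eval w env (bit_length e) = size (nat_bits (nth 0 T j)).
Proof.
move=> ej jT; have te := token_end jT; set L := size _ in te *.
rewrite /bit_length /= ej.
(* After [N - k] rounds the counter is [N - k], or [L] once the terminator is reached; all [N]
   rounds give [L], as [L <= N]. *)
pose P (k acc : nat) := acc = minn (N - k) L.
set v := loop _ _ _; suff : P 0 v by rewrite /P; lia.
apply: loop_ind => [|k acc kN]; rewrite /P; first by lia.
move=> ea /=; rewrite eval_offset /=; [|lia..].
have -> : minn (start j + (acc + acc)) N = start j + (acc + acc) by lia.
by rewrite nth_marker // -/L; [case: ifP; lia | lia].
Qed.

#[global] Opaque bit_length.

Lemma eval_skip_token env e j : eval w env e = start j -> j < size T ->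
  eval w env (skip_token e) = start j.+1.
Proof.
move=> ej jT; have te := token_end jT; rewrite startS //.
have eb := @eval_bit_length (start j :: env) (Var 0) j erefl jT.
by rewrite /skip_token /= ej eval_offset /= ?eb; lia.
Qed.

#[global] Opaque skip_token.

Lemma eval_position env e j : eval w env e = j -> j <= size T ->
  eval w env (position e) = start j.
Proof.
move=> ej jT; pose P (k acc : nat) := acc = start (j - k).
suff : P 0 (eval w env (position e)) by rewrite /P subn0.
rewrite /position /= ej; apply: loop_ind => [|k acc kj]; rewrite /P.
  by rewrite subnn /start take0.
move=> ->; rewrite (@eval_skip_token _ _ (j - k.+1)) //; last lia.
by congr start; lia.
Qed.

#[global] Opaque position.

Lemma eval_token env e j : eval w env e = j -> j < size T -> nth 0 T j <= N ->
  eval w env (token e) = nth 0 T j.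
Proof.
move=> ej jT jN; have te := token_end jT.
rewrite /token /= (eval_position ej (ltnW jT)).
rewrite (@eval_bit_length _ _ j) //.
rewrite -{1}[nth 0 T j]bits_valueK in jN.
set bs := nat_bits _ in te jN *.
pose P (k acc : nat) := acc = bits_value (drop k bs).
rewrite -[RHS]bits_valueK -/bs -[bs in RHS](drop0).
apply: (loop_ind (P := P)) => [|k acc kb]; rewrite /P; first by rewrite drop_size.
have := bits_value_drop k bs; rewrite (drop_nth false kb) /= => le ea.
rewrite -ea in le *; rewrite !eval_offset ?eval_add /=; [|lia..].
have -> : minn (minn (start j + (k + k)) N).+1 N = (start j + (k + k)).+1 by lia.
by rewrite nth_bit // -/bs; case: (nth false bs k) le => le; lia.
Qed.

#[global] Opaque token.

Lemma eval_same_token env i j :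
  nth 0 env i < size T -> nth 0 env j < size T ->
  eval w env (same_token i j) = (nth 0 T (nth 0 env i) == nth 0 T (nth 0 env j)).
Proof.
set a := nth 0 env i; set b := nth 0 env j => aT bT.
have tea := token_end aT; have teb := token_end bT.
have pa := @eval_position env (Var i) a erefl (ltnW aT).
have pb := @eval_position (start a :: env) (Var j.+1) b erefl (ltnW bT).
have la := @eval_bit_length [:: start b, start a & env] (Var 1) a erefl aT.
have lb := @eval_bit_length [:: start b, start a & env] (Var 0) b erefl bT.
rewrite /same_token /= pa pb la lb.
set A := nat_bits (nth 0 T a) in tea *; set B := nat_bits (nth 0 T b) in teb *.
(* Binary digits determine the number, by [bits_valueK]. *)
have -> : (nth 0 T a == nth 0 T b) = (A == B).
  apply/eqP/eqP => [e|e]; first by rewrite /A /B e.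
  by rewrite -[LHS]bits_valueK -[RHS]bits_valueK -/A -/B e.
case: ifP => [/eqP sAB|/eqP sAB]; last first.
  by case: eqP => // e; case: sAB; rewrite e.
have -> : minn 1 N = 1 by have := size_tokens; lia.
rewrite (@loop_all (fun k => nth false A k == nth false B k)).
  congr nat_of_bool; apply/allP/eqP => [h|-> //].
  apply: (eq_from_nth (x0 := false)) => // k kA.
  by apply/eqP/h; rewrite mem_iota; lia.
move=> k acc kB _; rewrite !eval_offset /=; [|lia..].
have -> : minn (minn (start a + (k + k)) N).+1 N = (start a + (k + k)).+1 by lia.
have -> : minn (minn (start b + (k + k)) N).+1 N = (start b + (k + k)).+1 by lia.
by rewrite !nth_bit -/A -/B ?sAB //; do 2!case: nth.
Qed.

#[global] Opaque same_token.

End Tokens.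

(** * Committees that may fail justified representation *)

(** A voter with lottery [l] may come to approve [c] and yet have no representative in [W]. *)
Definition deniable (W : seq nat) (c : nat) (l : seq entry) : bool :=
  has (fun e : entry => (c \in e.2) && ~~ has (mem W) e.2) l.

Section Combinatorics.

Import Order.TTheory GRing.Theory Num.Theory.

Variables (I : lottery_instance) (W : seq nat).
Hypothesis wf : wf_input I W.
Local Notation n := (li_n I).
Local Notation m := (li_m I).

Lemma lam_ge0 (e : entry) : (0 <= lam e)%R.
Proof. by rewrite divr_ge0 ?ler0n. Qed.

(** The product is positive iff no factor vanishes; the listed probabilities being positive, the
    factor of voter [i] vanishes exactly when no listed set equals [A i]. *)
Lemma plausibleP (A : profile I) :
  plausible A <->
  forall i : 'I_n, has (fun e : entry => toset m e.2 == A i) (voter_lot I i).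
Proof.
case: wf => _ _ _ hl _; rewrite /plausible /prob_profile; split=> [pA i|hA].
  have : (\prod_(i : 'I_n) \sum_(e <- voter_lot I i | toset m e.2 == A i) lam e
      != 0)%R by rewrite gt_eqF.
  move/prodf_neq0/(_ i isT); apply: contraR => hn.
  by rewrite big_hasC.
apply: prodr_gt0 => i _; have /hasP[e el eA] := hA i.
rewrite (big_rem e el) /= eA.
have [/allP/(_ e el)/and3P[p q _] _] := hl i (ltn_ord i).
by rewrite ltr_pwDl ?sumr_ge0 // => *; rewrite ?lam_ge0 // divr_gt0 ?ltr0n.
Qed.

Lemma candidate_lt i (e : entry) c :
  i < n -> e \in voter_lot I i -> c \in e.2 -> c < m.
Proof.
case: wf => _ _ _ hl _ iN el ce.
by have [/allP/(_ e el)/and3P[_ _ /allP/(_ c ce)]] := hl i iN.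
Qed.

Lemma meets_toset i (e : entry) : i < n -> e \in voter_lot I i ->
  (toset m e.2 :&: toset m W != set0) = has (mem W) e.2.
Proof.
move=> iN el; apply/set0Pn/hasP => [[x]|[c ce cW]].
  by rewrite !inE => /andP[xe xW]; exists (val x).
by exists (Ordinal (candidate_lt iN el ce)); rewrite !inE ce.
Qed.

Lemma card_deniable c :
  #|[set i : 'I_n | deniable W c (voter_lot I i)]| =
    count (deniable W c) (li_lot I).
Proof.
case: wf => _ _ sl _ _.
rewrite -sum1_card -sum1_count (big_nth [::]) sl big_mkord.
by apply: eq_bigl => i; rewrite inE.
Qed.

Lemma NecJRP :
  NecJR I W <-> forall c, count (deniable W c) (li_lot I) * li_k I < n.
Proof.
have [n0 k0 sl hl [uW sW aW]] := wf.
have ratE (v : nat) : (n%:R / (li_k I)%:R <= v%:R :> rat)%R = (n <= v * li_k I).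
  by rewrite ler_pdivrMr ?ltr0n // -natrM ler_nat.
split=> [nec c|hc A /plausibleP pA V' hV /set0Pn[c /bigcapP cV]]; last first.
  (* If no member of [V'] were represented, each would have a listed set containing the common
     candidate [c] and avoiding [W]; then [V'] would lie inside the deniable voters of [c], which
     are too few. *)
  suff /exists_inP[i iV iA] : [exists (i | i \in V'), A i :&: toset m W != set0].
    by exists i.
  apply: contraLR (hc c); rewrite negb_exists_in -leqNgt => /forall_inP hn.
  rewrite ratE in hV; apply: leq_trans hV _.
  rewrite leq_mul2r -card_deniable subset_leq_card ?orbT //.
  apply/subsetP => i iV; rewrite inE; have /hasP[e el /eqP eA] := pA i.
  apply/hasP; exists e => //; have := hn i iV; rewrite negbK -eA.
  rewrite -[_ == set0]negbK (meets_toset (ltn_ord i) el) => ->.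
  by have := cV i iV; rewrite -eA inE => ->.
rewrite ltnNge; apply/negP => hn.
set D := [set i : 'I_n | deniable W c (voter_lot I i)].
(* As [n > 0], the violated bound forces a deniable voter; hence [c] occurs in a listed set and is a
   genuine candidate. *)
have [i0 i0D] : exists i, i \in D.
  apply/set0Pn; apply: contraL hn => /eqP D0.
  by rewrite -card_deniable -/D D0 cards0 -ltnNge.
have cm : c < m.
  move: i0D; rewrite inE => /hasP[e el /andP[ce _]].
  exact: candidate_lt (ltn_ord i0) el ce.
pose e0 : entry := (0, 0, [::]).
pose good (e : entry) := (c \in e.2) && ~~ has (mem W) e.2.
(* The bad profile: deniable voters take a witnessing set, the others their first listed set, which
   exists because the probabilities sum to 1. *)
pose pick (i : 'I_n) := let l := voter_lot I i in
  if has good l then nth e0 l (find good l) else nth e0 l 0.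
have lot0 (i : 'I_n) : 0 < size (voter_lot I i).
  have [_ s1] := hl i (ltn_ord i); rewrite lt0n size_eq0.
  by apply/eqP => l0; move: s1; rewrite l0 big_nil.
have pickP (i : 'I_n) : pick i \in voter_lot I i.
  by rewrite /pick; case: ifP => h; apply: mem_nth; rewrite -?has_find.
have [|||i iD] := nec (fun i => toset m (pick i).2) _ D.
- by apply/plausibleP => i; apply/hasP; exists (pick i).
- by rewrite ratE card_deniable.
- apply/set0Pn; exists (Ordinal cm); apply/bigcapP => i; rewrite !inE => iD.
  by have /andP[] : good (pick i) by rewrite /pick [has _ _]iD; apply: nth_find.
rewrite (meets_toset (ltn_ord i) (pickP i)); apply/negP.
move: iD; rewrite inE => iD.
by have /andP[] : good (pick i) by rewrite /pick [has _ _]iD; apply: nth_find.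
Qed.

End Combinatorics.

(** * Deciding the condition *)

(** The tokens [n], [m], [k] come first, so this is the index of the first voter block. *)
Definition Three : expr := Inc (Inc (Inc Zero)).

Definition voter_count : expr := token Zero.
Definition committee_size : expr := token (Inc (Inc Zero)).

Definition next_entry (e : expr) : expr :=
  Let e (add (Inc (Inc (Inc (Var 0)))) (token (Inc (Inc (Var 0))))).

Definition next_voter (e : expr) : expr :=
  Let e (Iter (token (Var 0)) (Inc (Var 0)) (next_entry (Var 0))).

(** At [voter_count] this is the index just past the last block, where the token [size W] stands. *)
Definition voter (e : expr) : expr := Iter e Three (next_voter (Var 0)).

Definition in_committee (e : expr) : expr :=
  Let e (Let (voter voter_count) (Iter committee_size Zero
    (Let (Inc (add (Var 2) (Var 1)))
       (IfEq (same_token 0 4) Zero (Var 1) One)))).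

(* The index of the element of number [Var 1] in the approval set of the entry
   that starts at token [Var i]. *)
Definition element (i : nat) : expr := add (Inc (Inc (Inc (Var i)))) (Var 1).

Definition contains (i j : nat) : expr :=
  Iter (token (Inc (Inc (Var i)))) Zero
    (Let (element i.+2) (IfEq (same_token 0 j.+3) Zero (Var 1) One)).

Definition avoids_committee (i : nat) : expr :=
  Iter (token (Inc (Inc (Var i)))) One
    (Let (element i.+2) (IfEq (in_committee (Var 0)) Zero (Var 1) Zero)).

Definition deniable_voter (i j : nat) : expr :=
  Iter (token (Var i)) Zero
    (Let (Iter (Var 1) (Inc (Var i.+2)) (next_entry (Var 0)))
       (IfEq (contains 0 j.+3) Zero (Var 1)
          (IfEq (avoids_committee 0) Zero (Var 1) One))).

Definition deniable_count (j : nat) : expr :=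
  Iter voter_count Zero
    (Let (voter (Var 1))
       (IfEq (deniable_voter 0 j.+3) Zero (Var 1) (Inc (Var 1)))).

(** Every token before the committee is tried as a candidate. Tokens that are not candidates do no
    harm, the condition being required of all numbers. The product with [k] is a repeated saturating
    addition, and a zero difference signals a violation. *)
Definition decide_NecJR : expr :=
  Iter (voter voter_count) One
    (Let (deniable_count 1)
       (IfEq (sub voter_count (Iter committee_size Zero (add (Var 0) (Var 2))))
          Zero Zero (Var 1))).

(** * Positions in a concatenation of blocks *)

Section Blocks.

Variable ss : seq (seq nat).

Definition block_start (i : nat) : nat := size (flatten (take i ss)).

Lemma block_startS i : i < size ss ->
  block_start i.+1 = block_start i + size (nth [::] ss i).
Proof.
by move=> il; rewrite /block_start (take_nth [::] il) flatten_rcons size_cat.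
Qed.

Lemma block_start_le i : block_start i <= size (flatten ss).
Proof.
by rewrite /block_start -{2}(cat_take_drop i ss) flatten_cat size_cat leq_addr.
Qed.

Lemma block_start_size : block_start (size ss) = size (flatten ss).
Proof. by rewrite /block_start take_size. Qed.

Lemma size_le_flatten : all (fun s => 0 < size s) ss -> size ss <= size (flatten ss).
Proof.
by elim: ss => //= s ss' IH /andP[s0 /IH]; rewrite size_cat; lia.
Qed.

Lemma nth_block i u : i < size ss -> u < size (nth [::] ss i) ->
  nth 0 (flatten ss) (block_start i + u) = nth 0 (nth [::] ss i) u.
Proof.
move=> il ul; rewrite -{1}(cat_take_drop i ss) (drop_nth [::] il) flatten_cat.
rewrite nth_cat ifF; last by rewrite /block_start; lia.
by rewrite addKn /= nth_cat ul.
Qed.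

End Blocks.

(** * Layout of the token list and evaluation of the decision expressions *)

Section Layout.

Variables (I : lottery_instance) (W : seq nat).
Hypothesis wf : wf_input I W.
Local Notation n := (li_n I).
Local Notation k := (li_k I).
Let T := nats_of_input I W.
Let w := encode I W.
Local Notation N := (size w).

Definition voter_block (l : seq entry) : seq nat :=
  size l :: flatten (map nats_of_entry l).

Let blocks := map voter_block (li_lot I).

Definition vstart (i : nat) : nat := 3 + block_start blocks i.

(** The successor skips the token that gives the number of entries. *)
Definition estart (i j : nat) : nat :=
  (vstart i).+1 + block_start (map nats_of_entry (voter_lot I i)) j.

Let null_entry : entry := (0, 0, [::]).
Local Notation ent i j := (nth null_entry (voter_lot I i) j).

Lemma size_lot : size (li_lot I) = n. Proof. by case: wf. Qed.
Lemma size_committee : size W = k. Proof. by case: wf => _ _ _ _ []. Qed.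

Lemma tokensE : T = [:: n, li_m I, k & flatten blocks ++ size W :: W].
Proof. by []. Qed.

Lemma size_tokens_blocks : size T = 3 + (size (flatten blocks) + (size W).+1).
Proof. by rewrite tokensE /= size_cat. Qed.

Lemma size_tokens_le : size T <= N. Proof. exact: size_tokens. Qed.

Lemma vstart_end : vstart n = 3 + size (flatten blocks).
Proof. by rewrite /vstart -size_lot -(size_map voter_block) block_start_size. Qed.

Lemma nth_committee u : nth 0 T (vstart n + u.+1) = nth 0 W u.
Proof.
rewrite vstart_end tokensE addSn addSn addSn /= nth_cat ifF; last by lia.
by rewrite addKn.
Qed.

Lemma nth_blocks i : i < n -> nth [::] blocks i = voter_block (voter_lot I i).
Proof. by move=> il; rewrite (nth_map [::]) ?size_lot. Qed.

Lemma vstart_le i : vstart i <= vstart n.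
Proof. by rewrite vstart_end leq_add2l block_start_le. Qed.

Lemma vstart_lt i : vstart i < size T.
Proof.
rewrite (leq_ltn_trans (vstart_le i)) // vstart_end size_tokens_blocks; lia.
Qed.

Lemma vstartS i : i < n ->
  vstart i.+1 = vstart i + size (voter_block (voter_lot I i)).
Proof.
by move=> il; rewrite /vstart block_startS ?nth_blocks ?size_map ?size_lot // addnA.
Qed.

Lemma nth_voter i u : i < n -> u < size (voter_block (voter_lot I i)) ->
  nth 0 T (vstart i + u) = nth 0 (voter_block (voter_lot I i)) u.
Proof.
move=> il ul; rewrite -nth_blocks // -nth_block ?size_map ?size_lot ?nth_blocks //.
rewrite tokensE /vstart addSn addSn addSn /= nth_cat ifT //.
have := block_start_le blocks i.+1.
by rewrite block_startS ?nth_blocks ?size_map ?size_lot //; lia.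
Qed.

Lemma voter_token i : i < n -> nth 0 T (vstart i) = size (voter_lot I i).
Proof. by move=> il; have := @nth_voter i 0 il isT; rewrite addn0. Qed.

Lemma estart0 i : estart i 0 = (vstart i).+1.
Proof. by rewrite /estart /block_start take0 addn0. Qed.

Lemma estartS i j : j < size (voter_lot I i) ->
  estart i j.+1 = estart i j + (3 + size (ent i j).2).
Proof.
move=> jl; rewrite /estart block_startS ?size_map // (nth_map null_entry) //.
by rewrite addnA.
Qed.

Lemma estart_end i : i < n -> estart i (size (voter_lot I i)) = vstart i.+1.
Proof.
move=> il; rewrite vstartS // /estart -(size_map nats_of_entry) block_start_size.
by rewrite /= addSnnS.
Qed.

Lemma estart_le i j : i < n -> estart i j <= vstart i.+1.
Proof.
move=> il; rewrite vstartS // /estart /= addSnnS leq_add2l ltnS.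
exact: block_start_le.
Qed.

Lemma nth_entry i j u : i < n -> j < size (voter_lot I i) ->
  u < 3 + size (ent i j).2 ->
  nth 0 T (estart i j + u) = nth 0 (nats_of_entry (ent i j)) u.
Proof.
move=> il jl ul.
rewrite /estart addSnnS -addnA nth_voter //=.
  by rewrite nth_block ?size_map // (nth_map null_entry).
rewrite addSn ltnS.
have := block_start_le (map nats_of_entry (voter_lot I i)) j.+1.
by rewrite block_startS ?size_map // (nth_map null_entry) //=; lia.
Qed.

Lemma entry_token i j : i < n -> j < size (voter_lot I i) ->
  nth 0 T (estart i j).+2 = size (ent i j).2.
Proof. by move=> il jl; rewrite -addn2 nth_entry. Qed.

Lemma element_token i j u : i < n -> j < size (voter_lot I i) ->
  u < size (ent i j).2 ->
  nth 0 T ((estart i j).+3 + u) = nth 0 (ent i j).2 u.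
Proof.
move=> il jl ul; have -> : (estart i j).+3 + u = estart i j + u.+3 by lia.
by rewrite nth_entry.
Qed.

(** Every listed approval set lies before the committee, so the loop over candidate tokens meets all
    its elements. *)
Lemma element_end i j : i < n -> j < size (voter_lot I i) ->
  (estart i j).+3 + size (ent i j).2 <= vstart n.
Proof.
move=> il jl; apply: leq_trans (vstart_le i.+1).
by apply: leq_trans (estart_le j.+1 il); rewrite estartS //; lia.
Qed.

(** These inequalities show that token indices and the counts [n] and [k] stay within [N], so
    saturation does not disturb them. *)
Lemma bounds : [/\ 3 <= vstart n, n <= vstart n, k < size T - vstart n,
  vstart n < size T & size T <= N].
Proof.
split; [by rewrite /vstart | | | exact: vstart_lt | exact: size_tokens_le];
  last first.
  by rewrite size_tokens_blocks vstart_end size_committee; lia.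
rewrite vstart_end -size_lot -(size_map voter_block) -/blocks.
apply: leq_trans (leq_addl _ _); apply: size_le_flatten.
by rewrite all_map; apply/allP.
Qed.

Lemma eval_token_at env e j v : eval w env e = j -> j < size T ->
  nth 0 T j = v -> v <= N -> eval w env (token e) = v.
Proof. by move=> ej jT <- vN; apply: (eval_token ej). Qed.

Lemma eval_voter_count env : eval w env voter_count = n.
Proof.
have [b0 b1 b2 b3 b4] := bounds.
by apply: (@eval_token_at _ Zero 0) => //; lia.
Qed.

Lemma eval_committee_size env : eval w env committee_size = k.
Proof.
have [b0 b1 b2 b3 b4] := bounds.
have e2 : eval w env (Inc (Inc Zero)) = 2 by rewrite /=; lia.
by apply: (eval_token_at e2) => //; lia.
Qed.

#[global] Opaque voter_count committee_size.

Lemma eval_next_entry env e i j : i < n -> j < size (voter_lot I i) ->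
  eval w env e = estart i j -> eval w env (next_entry e) = estart i j.+1.
Proof.
move=> il jl ee; have [b0 b1 b2 b3 b4] := bounds; have le := element_end il jl.
rewrite /next_entry /= ee eval_add /=; last lia.
have e2 : eval w (estart i j :: env) (Inc (Inc (Var 0))) = (estart i j).+2.
  by rewrite /=; lia.
rewrite (eval_token_at e2 _ (entry_token il jl)); [|lia..].
by rewrite estartS //; lia.
Qed.

#[global] Opaque next_entry.

Lemma eval_entry env e f i j : i < n -> j <= size (voter_lot I i) ->
  eval w env e = j -> eval w env f = estart i 0 ->
  eval w env (Iter e f (next_entry (Var 0))) = estart i j.
Proof.
move=> il jl ee ef; rewrite /= ee ef.
pose P (k acc : nat) := acc = estart i (j - k).
rewrite -[in RHS](subn0 j); apply: (loop_ind (P := P)) => [|u acc uj]; rewrite /P.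
  by rewrite subnn.
move=> -> /=; rewrite (@eval_next_entry _ _ i (j - u.+1)) //; last lia.
by congr estart; lia.
Qed.

Lemma size_lot_le i : i < n -> size (voter_lot I i) <= N.
Proof.
move=> il; have [b0 b1 b2 b3 b4] := bounds; have := vstart_le i.+1.
have : size (voter_lot I i) <= size (flatten (map nats_of_entry (voter_lot I i))).
  rewrite -(size_map nats_of_entry); apply: size_le_flatten.
  by rewrite all_map; apply/allP.
by rewrite vstartS //=; lia.
Qed.

Lemma eval_next_voter env e i : i < n ->
  eval w env e = vstart i -> eval w env (next_voter e) = vstart i.+1.
Proof.
move=> il ee; have [b0 b1 b2 b3 b4] := bounds.
have vT := vstart_lt i; have le := estart_le 0 il; rewrite estart0 in le.
have le2 := vstart_le i.+1.
have sl := size_lot_le il.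
rewrite -estart_end // -(eval_entry (env := vstart i :: env) (e := token (Var 0))
  (f := Inc (Var 0)) il (leqnn _)).
- by rewrite /next_voter /= ee.
- by apply: (@eval_token_at _ _ (vstart i)); rewrite ?voter_token.
- by rewrite /= estart0; lia.
Qed.

#[global] Opaque next_voter.

Lemma eval_voter env e i : i <= n ->
  eval w env e = i -> eval w env (voter e) = vstart i.
Proof.
move=> il ee; have [b0 b1 b2 b3 b4] := bounds; rewrite /voter /= ee.
pose P (k acc : nat) := acc = vstart (i - k).
rewrite -[in RHS](subn0 i); apply: (loop_ind (P := P)) => [|u acc ui]; rewrite /P.
  rewrite subnn /vstart /block_start take0 /=.
  by have := vstart_lt 0; rewrite /vstart; lia.
move=> -> /=; rewrite (@eval_next_voter _ _ (i - u.+1)) //; last lia.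
by congr vstart; lia.
Qed.

#[global] Opaque voter.

Lemma eval_in_committee env e x : eval w env e = x -> x < size T ->
  eval w env (in_committee e) = (nth 0 T x \in W).
Proof.
move=> ex xT; have [b0 b1 b2 b3 b4] := bounds.
rewrite /in_committee /= ex eval_committee_size.
rewrite (eval_voter (leqnn n)) ?eval_voter_count //.
rewrite (@loop_has (fun u => nth 0 W u == nth 0 T x)).
  congr nat_of_bool; apply/hasP/(nthP 0).
    by move=> [u]; rewrite mem_iota => uk /eqP <-; exists u; rewrite ?size_committee.
  by move=> [u uk <-]; exists u => //; rewrite mem_iota -size_committee.
move=> u acc uk _; rewrite eval_add /=; last lia.
have -> : minn (minn (vstart n + u) N).+1 N = vstart n + u.+1 by lia.
have uT : vstart n + u.+1 < size T by lia.
rewrite (_ : eval _ _ (same_token 0 4) = (nth 0 T (vstart n + u.+1) == nth 0 T x));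
  last exact: (@eval_same_token T).
by rewrite nth_committee; case: (nth 0 W u == nth 0 T x) => //=; lia.
Qed.

#[global] Opaque in_committee.

Section Entry.

Variables (env : seq nat) (a i j : nat).
Hypotheses (il : i < n) (jl : j < size (voter_lot I i)).
Hypothesis ea : nth 0 env a = estart i j.

Lemma eval_set_size :
  eval w env (token (Inc (Inc (Var a)))) = size (ent i j).2.
Proof.
have [b0 b1 b2 b3 b4] := bounds; have le := element_end il jl.
have e2 : eval w env (Inc (Inc (Var a))) = (estart i j).+2 by rewrite /= ea; lia.
by apply: (eval_token_at e2 _ (entry_token il jl)); lia.
Qed.

Lemma eval_element acc u : u < size (ent i j).2 ->
  eval w [:: acc, u & env] (element a.+2) = (estart i j).+3 + u.
Proof.
move=> uS; have [b0 b1 b2 b3 b4] := bounds; have le := element_end il jl.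
by rewrite /element eval_add /= ea; lia.
Qed.

Lemma eval_contains c : nth 0 env c < size T ->
  eval w env (contains a c) = (nth 0 T (nth 0 env c) \in (ent i j).2).
Proof.
move=> cT; have [b0 b1 b2 b3 b4] := bounds; have le := element_end il jl.
rewrite /contains /= eval_set_size.
rewrite (@loop_has (fun u => nth 0 (ent i j).2 u == nth 0 T (nth 0 env c))).
  congr nat_of_bool; apply/hasP/(nthP 0).
    by move=> [u]; rewrite mem_iota => uk /eqP <-; exists u.
  by move=> [u uk <-]; exists u => //; rewrite mem_iota.
move=> u acc uk _; rewrite eval_element //.
have uT : (estart i j).+3 + u < size T by lia.
rewrite (_ : eval _ _ (same_token 0 c.+3) =
    (nth 0 T ((estart i j).+3 + u) == nth 0 T (nth 0 env c)));
  last exact: (@eval_same_token T).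
by rewrite element_token //; case: (_ == nth 0 T (nth 0 env c)) => //=; lia.
Qed.

Lemma eval_avoids_committee :
  eval w env (avoids_committee a) = ~~ has (mem W) (ent i j).2.
Proof.
have [b0 b1 b2 b3 b4] := bounds; have le := element_end il jl.
rewrite /avoids_committee /= eval_set_size.
have -> : minn 1 N = 1 by lia.
rewrite (@loop_all (fun u => nth 0 (ent i j).2 u \notin W)).
  congr nat_of_bool; rewrite -all_predC.
  apply/allP/(all_nthP 0) => [h u uS|h u]; first by apply: h; rewrite mem_iota.
  by rewrite mem_iota => uS; apply: h.
move=> u acc uk _; rewrite eval_element //.
rewrite (@eval_in_committee _ _ ((estart i j).+3 + u)) //; last lia.
by rewrite element_token //; case: (_ \in _).
Qed.

End Entry.
#[global] Opaque contains avoids_committee.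

Lemma eval_deniable_voter env a c i : i < n -> nth 0 env a = vstart i ->
  nth 0 env c < size T ->
  eval w env (deniable_voter a c) =
    deniable W (nth 0 T (nth 0 env c)) (voter_lot I i).
Proof.
move=> il ea cT; have [b0 b1 b2 b3 b4] := bounds.
have le := estart_le 0 il; have le2 := vstart_le i.+1; rewrite estart0 in le.
have ln := size_lot_le il.
rewrite /deniable_voter /=.
rewrite (@eval_token_at _ _ (vstart i) (size (voter_lot I i))) ?voter_token //;
  last exact: vstart_lt.
pose x := nth 0 T (nth 0 env c).
rewrite (@loop_has (fun j => (x \in (ent i j).2) && ~~ has (mem W) (ent i j).2)).
  congr nat_of_bool; apply/hasP/(has_nthP null_entry).
    by move=> [j]; rewrite mem_iota => jl; exists j.
  by move=> [j jl h]; exists j => //; rewrite mem_iota.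
move=> j acc jl _.
have := @eval_entry [:: acc, j & env] (Var 1) (Inc (Var a.+2)) i j il (ltnW jl)
  erefl.
rewrite /= ea estart0 => -> //; last lia.
rewrite (@eval_contains _ 0 i j) // (@eval_avoids_committee _ 0 i j) //= -/x.
by case: (x \in _) => //=; case: has => //=; lia.
Qed.

#[global] Opaque deniable_voter.

Lemma eval_deniable_count env c : nth 0 env c < size T ->
  eval w env (deniable_count c) =
    count (deniable W (nth 0 T (nth 0 env c))) (li_lot I).
Proof.
move=> cT; have [b0 b1 b2 b3 b4] := bounds.
rewrite /deniable_count /= eval_voter_count.
rewrite (@loop_count (fun i => deniable W (nth 0 T (nth 0 env c)) (voter_lot I i))).
  rewrite -[in RHS](mkseq_nth [::] (li_lot I)) /mkseq count_map size_lot.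
  by apply: eq_count => i.
move=> i acc il an; rewrite (@eval_voter _ _ i) //=; last exact: ltnW.
rewrite (@eval_deniable_voter _ 0 c.+3 i) //=.
by case: deniable => //=; lia.
Qed.

#[global] Opaque deniable_count.

Lemma eval_decide_NecJR :
  0 < eval w [::] decide_NecJR <->
  forall c, count (deniable W c) (li_lot I) * k < n.
Proof.
have [b0 b1 b2 b3 b4] := bounds.
rewrite /decide_NecJR /= (eval_voter (leqnn n)) ?eval_voter_count //.
have -> : minn 1 N = 1 by lia.
rewrite (@loop_all (fun j => count (deniable W (nth 0 T j)) (li_lot I) * k < n));
    last first.
  move=> j acc jl _; rewrite eval_deniable_count /=; last by apply: ltn_trans jl b3.
  set s := count _ _; rewrite eval_sub /= eval_voter_count eval_committee_size.
  (* Saturation is harmless here: as [n <= N], the truncated product still decides whether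
     [n <= s * k]. *)
  set v := loop _ _ _; have -> : v = minn (s * k) N.
    rewrite /v; pose P (u acc : nat) := acc = minn (s * (k - u)) N.
    rewrite -[in RHS](subn0 k); apply: (loop_ind (P := P)) => [|u t uk]; rewrite /P.
      by rewrite subnn muln0 min0n.
    move=> ->; rewrite eval_add /=; last exact: geq_minr.
    by rewrite -[k - u]prednK ?subn_gt0 // mulnS -subnS; lia.
  by case: eqP => e; case: ltnP => //; lia.
split=> [|h]; last by rewrite (_ : all _ _ = true) //; apply/allP.
rewrite lt0b => /allP h c; rewrite ltnNge; apply/negP => nc.
(* A violating [c] has a deniable voter because [n > 0]; it therefore occurs as an element of some
   entry, and its token index is among those tried. *)
have /hasP[l lI /hasP[e el /andP[ce ne]]] : has (deniable W c) (li_lot I).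
  rewrite has_count; apply: contraLR nc; rewrite -eqn0Ngt -ltnNge => /eqP ->.
  by case: wf.
have [i il di] := nthP [::] lI; have [j jl dj] := nthP null_entry el.
have [u ul du] := nthP 0 ce; rewrite size_lot in il.
rewrite -di -/(voter_lot I i) in jl dj; rewrite -dj in ul du.
have uv : (estart i j).+3 + u < vstart n.
  by apply: leq_trans (element_end il jl); rewrite ltn_add2l.
have := h ((estart i j).+3 + u); rewrite mem_iota add0n uv => /(_ isT).
by rewrite element_token // du ltnNge nc.
Qed.

End Layout.

Theorem theorem2 :
  exists (M : TM) (c d : nat),
    forall (I : lottery_instance) (W : seq nat),
      wf_input I W ->
      exists t : nat,
        [/\ t <= c * (size (encode I W)) ^ d + c,
            tm_halt (cstate (tm_run M t (encode I W)))
          & tm_acc (cstate (tm_run M t (encode I W))) <-> NecJR I W].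
Proof.
have [M [c [d hM]]] := eval_TM decide_NecJR; exists M, c, d => I W wf.
have [t [tle th ta]] := hM (encode I W); exists t; split=> //.
by rewrite ta (eval_decide_NecJR wf) (NecJRP wf).
Qed.
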